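(* Let $\Phi,\Psi$ be join doctrines with $\omega\in\Phi$ and $\Phi$ a sound join doctrine dual to $\Psi^{\mathrm{op}}$. For every Archimedean unstackable $\mathbb{U}$-$\Psi^{\mathrm{op}}$-inflattice $A$, the evaluation map $\iota:A\to\Phi\mathbf{CtsLat}(\mathbb{U}\Psi^{\mathrm{op}}\mathbf{Inf}(A,\mathbb{I}),\mathbb{I})$, $\iota(a)(f)=f(a)$, is an embedding. If $A$ is stackable, the image of $\iota$ is dense (with respect to the metric $\mathrm{dist}$ of the codomain); thus if $A$ is also complete, $\iota$ is an isomorphism.
   Context: Join doctrine: class $\Phi$ of posets containing the one-element poset, closed under unions $\bigcup\mathcal{S}$ of sets $\mathcal{S}$ of subposets in $\Phi$ with $\mathcal{S}$ (by inclusion) in $\Phi$, under codomains of monotone maps with cofinal image, and under cofinal subposets. $\mathcal{L}(X)$ = lower sets of poset $X$, $\Phi(X)$ = those in $\Phi$; $\Phi$-join = join of a subset in $\Phi$; $\Psi^{\mathrm{op}}$-meet = meet of a subset $S$ with $S^{\mathrm{op}}\in\Psi$; $\omega$ = naturals. $\Phi$ sound dual to $\Psi^{\mathrm{op}}$: for all posets $X,Y$, $\phi\in\Phi(Y)$, $\psi\in\Psi(X)$, monotone $F:X^{\mathrm{op}}\times Y\to2$, $\bigwedge_{x\in\psi}\bigvee_{y\in\phi}F=\bigvee_{y\in\phi}\bigwedge_{x\in\psi}F$; and for every $X$ the closure of $\Psi(X)$ in $\mathcal{L}(X)$ under unions of subfamilies in $\Phi$ is $\mathcal{L}(X)$. $\Phi$-continuous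 lattice: complete lattice where each $x$ has $\phi\in\Phi(X)$, $\phi\subseteq\Downarrow x:=\bigcap\{\phi'\in\Phi(X)\mid x\le\bigvee\phi'\}$, $x\le\bigvee\phi$; $\Phi\mathbf{CtsLat}(Y,\mathbb{I})$ = maps preserving arbitrary meets and $\Phi$-joins. $\mathbb{I}=[0,1]$; $\mathbb{U}$ = monoid of surjective monotone maps $\mathbb{I}\to\mathbb{I}$. $\mathbb{U}$-poset: poset with $\mathbb{U}$-action monotone in both variables; $\mathbb{U}$-$\Psi^{\mathrm{op}}$-inflattice: a $\mathbb{U}$-poset with all $\Psi^{\mathrm{op}}$-meets, each $u$ preserving them; $\mathbb{U}\Psi^{\mathrm{op}}\mathbf{Inf}(A,\mathbb{I})$ = equivariant monotone $\Psi^{\mathrm{op}}$-meet-preserving maps, ordered pointwise; it is a $\Phi$-continuous lattice. The codomain of $\iota$ is a $\mathbb{U}$-$\Psi^{\mathrm{op}}$-inflattice with pointwise order, meets and action. In a $\mathbb{U}$-poset: $a\le_r b$ iff $u(a)\le v(b)$ for all $u,v\in\mathbb{U}$ with $u(t\dotplus r)\le v(t)$ for all $t$ ($\dotplus$ truncated addition); $\rho(a,b)=\bigwedge\{r\mid a\le_rb\}$; $\mathrm{dist}=\rho\vee\rho^{\mathrm{op}}$. Archimedean: ($\forall r>0$, $a\le_r b$) $\Rightarrow a\le b$; complete: Archimedean and $\mathrm{dist}$-complete. Unstackable: for $0<r<1$ and $u,v\in\mathbb{U}$ restricting to order-isomorphisms $u:[0,r]\cong[0,1]$, $v:[r,1]\cong[0,1]$,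 $u(a)\le u(b)\wedge v(a)\le v(b)\Rightarrow a\le b$; stackable: unstackable and for such $r,u,v$ and $a,b$ with $v'(b)\le u'(a)$ for all $u',v'\in\mathbb{U}$ there is $c$ with $u(c)=a$, $v(c)=b$. *)

(* Defs.v *)
From Stdlib Require Import Reals ProofIrrelevance FunctionalExtensionality PropExtensionality.
From Coquelicot Require Import Rbar Lub.
Open Scope R_scope.

Record Poset := {
  car :> Type;
  le : car -> car -> Prop;
  le_refl : forall x, le x x;
  le_trans : forall x y z, le x y -> le y z -> le x z;
  le_antisym : forall x y, le x y -> le y x -> x = y }.
Arguments le {p} _ _.

Definition sub (X : Poset) (P : X -> Prop) : Poset.
Proof.
  refine {| car := {x : X | P x}; le := fun a b => le (proj1_sig a) (proj1_sig b) |}.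
  - intros [x ?]; apply le_refl.
  - intros [x ?] [y ?] [z ?]; simpl; apply le_trans.
  - intros [x px] [y py]; simpl; intros H1 H2.
    pose proof (le_antisym X x y H1 H2); subst; f_equal; apply proof_irrelevance.
Defined.

Definition opp (X : Poset) : Poset.
Proof.
  refine {| car := car X; le := fun a b => le b a |}.
  - intros; apply le_refl.
  - intros x y z H1 H2; exact (le_trans X _ _ _ H2 H1).
  - intros x y H1 H2; exact (le_antisym X _ _ H2 H1).
Defined.

Definition powerset (X : Poset) : Poset.
Proof.
  refine {| car := X -> Prop; le := fun P Q => forall x, P x -> Q x |}.
  - auto.
  - auto.
  - intros P Q H1 H2; apply functional_extensionality; intro x;
      apply propositional_extensionality; split; auto.
Defined.

Definition unit_poset : Poset.
Proof.
  refine {| car := unit; le := fun _ _ => True |}; auto.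
  intros [] [] _ _; reflexivity.
Defined.

Definition omega : Poset.
Proof.
  refine {| car := nat; le := Peano.le |}.
  - exact Nat.le_refl.
  - exact Nat.le_trans.
  - exact Nat.le_antisymm.
Defined.

Definition monotone {X Y : Poset} (f : X -> Y) : Prop :=
  forall x y, le x y -> le (f x) (f y).

Definition cofinal (X : Poset) (P : X -> Prop) : Prop :=
  forall x, exists y, P y /\ le x y.

Definition PClass := Poset -> Prop.

Definition bigU {X : Type} (S : (X -> Prop) -> Prop) : X -> Prop :=
  fun x => exists P, S P /\ P x.

Definition is_join_doctrine (Phi : PClass) : Prop :=
  Phi unit_poset /\
  (forall (X : Poset) (S : (X -> Prop) -> Prop),
      (forall P, S P -> Phi (sub X P)) ->
      Phi (sub (powerset X) S) ->
      Phi (sub X (bigU S))) /\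
  (forall (X Y : Poset) (f : X -> Y),
      Phi X -> monotone f -> (forall y, exists x, le y (f x)) -> Phi Y) /\
  (forall (X : Poset) (P : X -> Prop), Phi X -> cofinal X P -> Phi (sub X P)).

Definition lower (X : Poset) (P : X -> Prop) : Prop :=
  forall x y, le x y -> P y -> P x.
Definition inPhiX (Phi : PClass) (X : Poset) (P : X -> Prop) : Prop :=
  lower X P /\ Phi (sub X P).

Definition sound_dual (Phi Psi : PClass) : Prop :=
  (forall (X Y : Poset) (phi : Y -> Prop) (psi : X -> Prop) (F : X -> Y -> Prop),
      inPhiX Phi Y phi -> inPhiX Psi X psi ->
      (* F : X^op x Y -> 2 monotone *)
      (forall x x' y y', le x' x -> le y y' -> F x y -> F x' y') ->
      ((forall x, psi x -> exists y, phi y /\ F x y) <->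
       (exists y, phi y /\ forall x, psi x -> F x y))) /\
  (* the closure of Psi(X) in L(X) under unions of subfamilies in Phi is L(X) *)
  (forall (X : Poset) (C : (X -> Prop) -> Prop),
      (forall P, C P -> lower X P) ->
      (forall P, inPhiX Psi X P -> C P) ->
      (forall S, (forall P, S P -> C P) -> Phi (sub (powerset X) S) -> C (bigU S)) ->
      forall P, lower X P -> C P).

Definition is_glb (X : Poset) (S : X -> Prop) (m : X) : Prop :=
  (forall s, S s -> le m s) /\ (forall y, (forall s, S s -> le y s) -> le y m).
Definition is_lub (X : Poset) (S : X -> Prop) (j : X) : Prop :=
  (forall s, S s -> le s j) /\ (forall y, (forall s, S s -> le s y) -> le j y).

Definition inI (t : R) : Prop := 0 <= t <= 1.

(* elements of U: surjective monotone maps I -> I, represented as functions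
   R -> R normalised by u t = u (clamp t) so that they are determined by
   their values on I *)
Definition isU (u : R -> R) : Prop :=
  (forall t, inI t -> inI (u t)) /\
  (forall s t, inI s -> inI t -> s <= t -> u s <= u t) /\
  (forall y, inI y -> exists t, inI t /\ u t = y) /\
  (forall t, u t = u (Rmax 0 (Rmin 1 t))).
Definition U := {u : R -> R | isU u}.
Definition Ufun (u : U) : R -> R := proj1_sig u.
Coercion Ufun : U >-> Funclass.

Definition glbI (T : R -> Prop) (x : R) : Prop :=
  inI x /\ (forall t, T t -> x <= t) /\
  (forall y, inI y -> (forall t, T t -> y <= t) -> y <= x).
Definition lubI (T : R -> Prop) (x : R) : Prop :=
  inI x /\ (forall t, T t -> t <= x) /\
  (forall y, inI y -> (forall t, T t -> t <= y) -> x <= y).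

Definition image {X Y : Type} (f : X -> Y) (S : X -> Prop) : Y -> Prop :=
  fun y => exists x, S x /\ y = f x.

Record UPoset := {
  upos :> Poset;
  act : U -> upos -> upos;
  act_id : forall (e : U) a, (forall t, inI t -> e t = t) -> act e a = a;
  act_comp : forall (u v w : U) a, (forall t, inI t -> w t = u (v t)) ->
                act w a = act u (act v a);
  act_mono_l : forall (u v : U) a, (forall t, inI t -> u t <= v t) ->
                le (act u a) (act v a);
  act_mono_r : forall (u : U) a b, le a b -> le (act u a) (act u b) }.

Record UInfLat (Psi : PClass) := {
  uil :> UPoset;
  has_meets : forall S : uil -> Prop, Psi (opp (sub uil S)) -> exists m, is_glb uil S m;
  act_pres_meets : forall (u : U) (S : uil -> Prop) m,
      Psi (opp (sub uil S)) -> is_glb uil S m ->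
      is_glb uil (image (act uil u) S) (act uil u m) }.
Arguments uil {Psi} _.

Definition trunc_add (t r : R) : R := Rmin (t + r) 1.

Definition le_r {X : Type} (leX : X -> X -> Prop) (actX : U -> X -> X)
  (r : R) (a b : X) : Prop :=
  forall u v : U, (forall t, inI t -> u (trunc_add t r) <= v t) ->
    leX (actX u a) (actX v b).

Definition rho {X : Type} (leX : X -> X -> Prop) (actX : U -> X -> X) (a b : X) : R :=
  real (Glb_Rbar (fun r => 0 <= r /\ le_r leX actX r a b)).

Definition udist {X : Type} (leX : X -> X -> Prop) (actX : U -> X -> X) (a b : X) : R :=
  Rmax (rho leX actX a b) (rho leX actX b a).

Definition archimedean (A : UPoset) : Prop :=
  forall a b : A, (forall r, 0 < r -> le_r (@le A) (act A) r a b) -> le a b.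

Definition dist_complete (A : UPoset) : Prop :=
  forall s : nat -> A,
    (forall eps, 0 < eps -> exists N, forall m n, (N <= m)%nat -> (N <= n)%nat ->
        udist (@le A) (act A) (s m) (s n) < eps) ->
    exists a : A, forall eps, 0 < eps -> exists N, forall n, (N <= n)%nat ->
        udist (@le A) (act A) (s n) a < eps.

Definition complete (A : UPoset) : Prop := archimedean A /\ dist_complete A.

Definition restricts_iso (u : R -> R) (p q : R) : Prop :=
  (forall s t, p <= s <= q -> p <= t <= q -> (s <= t <-> u s <= u t)) /\
  (forall y, inI y -> exists t, p <= t <= q /\ u t = y).

Definition unstackable (A : UPoset) : Prop :=
  forall (r : R) (u v : U), 0 < r < 1 -> restricts_iso u 0 r -> restricts_iso v r 1 ->
    forall a b : A, le (act A u a) (act A u b) -> le (act A v a) (act A v b) -> le a b.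

Definition stackable (A : UPoset) : Prop :=
  unstackable A /\
  forall (r : R) (u v : U), 0 < r < 1 -> restricts_iso u 0 r -> restricts_iso v r 1 ->
    forall a b : A, (forall u' v' : U, le (act A v' b) (act A u' a)) ->
      exists c : A, act A u c = a /\ act A v c = b.

Definition is_UInf {Psi : PClass} (A : UInfLat Psi) (f : A -> R) : Prop :=
  (forall a, inI (f a)) /\
  (forall a b, le a b -> f a <= f b) /\
  (forall (u : U) a, f (act A u a) = u (f a)) /\
  (forall (S : A -> Prop) m, Psi (opp (sub A S)) -> is_glb A S m ->
      glbI (image f S) (f m)).

Definition UInfPoset {Psi : PClass} (A : UInfLat Psi) : Poset.
Proof.
  refine {| car := {f : A -> R | is_UInf A f};
            le := fun f g => forall a, proj1_sig f a <= proj1_sig g a |}.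
  - intros f a; apply Rle_refl.
  - intros f g h H1 H2 a; eapply Rle_trans; eauto.
  - intros [f pf] [g pg]; simpl; intros H1 H2.
    assert (f = g) by (apply functional_extensionality; intro a; apply Rle_antisym; auto).
    subst; f_equal; apply proof_irrelevance.
Defined.

Definition is_PhiCtsHom (Phi : PClass) (Y : Poset) (g : Y -> R) : Prop :=
  (forall y, inI (g y)) /\
  (forall (S : Y -> Prop) m, is_glb Y S m -> glbI (image g S) (g m)) /\
  (forall (S : Y -> Prop) j, Phi (sub Y S) -> is_lub Y S j -> lubI (image g S) (g j)).

Definition iota {Psi : PClass} (A : UInfLat Psi) (a : A) : UInfPoset A -> R :=
  fun f => proj1_sig f a.

Definition cod_le {Y : Type} (g h : Y -> R) : Prop := forall y, g y <= h y.
Definition cod_act {Y : Type} (u : U) (g : Y -> R) : Y -> R := fun y => u (g y).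

(* Main.v *)
From Stdlib Require Import Reals Lra Lia ClassicalEpsilon FunctionalExtensionality PropExtensionality.
From Coquelicot Require Import Rcomplements Rbar Lub.
Require Import Defs.
Open Scope R_scope.

(** For [a] in [A] and [0 <= x < 1] the map sending [c] to the supremum of those
    [y] such that "[a > x] implies [c >= y]" (that is, [u(a) <= v(c)] whenever
    [u] vanishes at [x] and [v] is [1] at [y]) is equivariant and preserves
    meets; it is essentially the least map exceeding [x] at [a].  If [a] is not
    below [b], the Archimedean property and unstackability localise the failure
    to some [y < x] for which "[a > x] implies [b >= y]" is false, and then this
    map separates [a] from [b].

    For density, soundness implies that a poset with all Psi-joins belongs to
    Phi, so the filter where a map takes value [1] indexes a Phi-join.  Applied
    to the least map where [g >= t], this yields for [s < t] an [a] such that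
    [f(a) = 1] when [g(f) >= t] and [f(a) = 0] when [g(f) <= s].  Stacking such
    elements for [s = k/N], [t = (k+1)/N] gives an element within [1/N] of [g]. *)

(** * The monoid of surjective monotone maps *)

Lemma U_clamp (u : U) t : u t = u (Rmax 0 (Rmin 1 t)).
Proof. destruct u as [u [? [? [? H]]]]; apply H. Qed.

Lemma inI_clamp t : inI (Rmax 0 (Rmin 1 t)).
Proof.
  unfold inI; pose proof (Rmin_l 1 t); split; [apply Rmax_l|].
  apply Rmax_lub; lra.
Qed.

Lemma U_range (u : U) t : inI (u t).
Proof.
  rewrite U_clamp; destruct u as [u [H ?]]; apply H, inI_clamp.
Qed.

Lemma U_mono (u : U) s t : s <= t -> u s <= u t.
Proof.
  intros Hst; rewrite (U_clamp u s), (U_clamp u t).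
  destruct u as [u [? [H ?]]]; apply H; try apply inI_clamp.
  apply Rle_max_compat_l, Rle_min_compat_l, Hst.
Qed.

Lemma U_surj (u : U) y : inI y -> exists t, inI t /\ u t = y.
Proof. destruct u as [u [? [? [H ?]]]]; apply H. Qed.

Lemma U_0 (u : U) t : t <= 0 -> u t = 0.
Proof.
  intros Ht; destruct (U_surj u 0) as [s [[Hs ?] E]]; [unfold inI; lra|].
  pose proof (U_range u t) as [? ?]; pose proof (U_mono u t s); lra.
Qed.

Lemma U_1 (u : U) t : 1 <= t -> u t = 1.
Proof.
  intros Ht; destruct (U_surj u 1) as [s [[Hs ?] E]]; [unfold inI; lra|].
  pose proof (U_range u t) as [? ?]; pose proof (U_mono u s t); lra.
Qed.

Lemma U_lt_inv (u : U) s t : u s < u t -> s < t.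
Proof.
  intros H; destruct (Rlt_le_dec s t) as [|Hts]; auto.
  pose proof (U_mono u t s Hts); lra.
Qed.

(** A preimage of the midpoint between [u x] and [y]. This stands in for continuity, which a
    monotone surjection has automatically. *)
Lemma U_between (u : U) x y : u x < y -> y <= 1 -> exists z, inI z /\ x < z /\ u x < u z < y.
Proof.
  intros H Hy; pose proof (U_range u x) as [? ?].
  destruct (U_surj u ((u x + y) / 2)) as [z [Hz E]]; [unfold inI; lra|].
  exists z; split; auto; split; [apply (U_lt_inv u)|]; lra.
Qed.

Lemma U_below (u : U) x y : y < u x -> 0 <= y -> exists z, inI z /\ z < x /\ y < u z < u x.
Proof.
  intros H Hy; pose proof (U_range u x) as [? ?].
  destruct (U_surj u ((u x + y) / 2)) as [z [Hz E]]; [unfold inI; lra|].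
  exists z; split; auto; split; [apply (U_lt_inv u)|]; lra.
Qed.

Lemma U_comp (u v : U) : exists w : U, forall t, w t = u (v t).
Proof.
  assert (H : isU (fun t => u (v t))).
  { split; [|split; [|split]].
    - intros; apply U_range.
    - intros; apply U_mono, U_mono; auto.
    - intros y Hy; destruct (U_surj u y Hy) as [s [Hs <-]].
      destruct (U_surj v s Hs) as [t [Ht <-]]; eauto.
    - intros t; rewrite (U_clamp v); reflexivity. }
  exists (exist _ _ H); reflexivity.
Qed.

Lemma U_ramp p q : 0 <= p -> p < q -> q <= 1 ->
  exists u : U, (forall t, t <= p -> u t = 0) /\ (forall t, q <= t -> u t = 1) /\
    (forall t, p <= t <= q -> u t = (t - p) / (q - p)).
Proof.
  intros Hp Hpq Hq.
  set (h := fun t => Rmax 0 (Rmin 1 ((t - p) / (q - p)))).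
  assert (H0 : forall t, t <= p -> h t = 0).
  { intros t Ht; apply Rmax_left.
    assert ((t - p) / (q - p) <= 0) by (apply Rle_div_l; lra).
    pose proof (Rmin_r 1 ((t - p) / (q - p))); lra. }
  assert (H1 : forall t, q <= t -> h t = 1).
  { intros t Ht; unfold h.
    assert (1 <= (t - p) / (q - p)) by (apply Rle_div_r; lra).
    rewrite Rmin_left, Rmax_right; lra. }
  assert (H2 : forall t, p <= t <= q -> h t = (t - p) / (q - p)).
  { intros t Ht; unfold h.
    assert ((t - p) / (q - p) <= 1) by (apply Rle_div_l; lra).
    assert (0 <= (t - p) / (q - p)) by (apply Rle_div_r; lra).
    rewrite Rmin_right, Rmax_right; lra. }
  assert (H : isU h).
  { split; [|split; [|split]].
    - intros; apply inI_clamp.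
    - intros s t _ _ Hst; apply Rle_max_compat_l, Rle_min_compat_l.
      apply Rmult_le_compat_r; [apply Rlt_le, Rinv_0_lt_compat|]; lra.
    - intros y [Hy0 Hy1]; exists (p + y * (q - p)).
      assert (p <= p + y * (q - p) <= q) by nra.
      split; [unfold inI; lra|]; rewrite H2; [field|]; lra.
    - intros t; destruct (Rle_lt_dec t 0).
      + rewrite Rmin_right, Rmax_left, !H0; lra.
      + destruct (Rle_lt_dec t 1).
        * rewrite Rmin_right, Rmax_right; lra.
        * rewrite Rmin_left, Rmax_right, !H1; lra. }
  exists (exist _ h H); auto.
Qed.

(** The multiplied form lets the halves be added: with the final ramp [v] for the same [r],
    [r * u t + (1 - r) * v t = t] on the unit interval. *)
Lemma U_ramp_initial r : 0 < r < 1 -> exists u : U, restricts_iso u 0 r /\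
  (forall t, r <= t -> u t = 1) /\ (forall t, 0 <= t <= r -> r * u t = t).
Proof.
  intros Hr; destruct (U_ramp 0 r) as [u [? [? H]]]; try lra.
  assert (H' : forall t, 0 <= t <= r -> r * u t = t)
    by (intros t Ht; rewrite H by lra; field; lra).
  exists u; split; [split|auto].
  - intros s t Hs Ht; pose proof (H' s Hs); pose proof (H' t Ht); split; intros; nra.
  - intros y [Hy Hy1]; exists (r * y); assert (0 <= r * y <= r) by nra.
    split; auto; rewrite H by lra; field; lra.
Qed.

Lemma U_ramp_final r : 0 < r < 1 -> exists v : U, restricts_iso v r 1 /\
  (forall t, t <= r -> v t = 0) /\ (forall t, r <= t <= 1 -> (1 - r) * v t = t - r).
Proof.
  intros Hr; destruct (U_ramp r 1) as [u [? [? H]]]; try lra.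
  assert (H' : forall t, r <= t <= 1 -> (1 - r) * u t = t - r)
    by (intros t Ht; rewrite H by lra; field; lra).
  exists u; split; [split|auto].
  - intros s t Hs Ht; pose proof (H' s Hs); pose proof (H' t Ht); split; intros; nra.
  - intros y [Hy Hy1]; exists (r + (1 - r) * y); assert (r <= r + (1 - r) * y <= 1) by nra.
    split; auto; rewrite H by lra; field; lra.
Qed.

Lemma U_trunc_add_le (u v : U) r : 0 <= r ->
  (forall t, inI t -> u (trunc_add t r) <= v t) -> forall t, u (t + r) <= v t.
Proof.
  intros Hr H.
  assert (HI : forall t, inI t -> u (t + r) <= v t).
  { intros t Ht; eapply Rle_trans; [|apply H, Ht].
    unfold trunc_add, Rmin; destruct (Rle_dec (t + r) 1); [lra|].
    rewrite !U_1; lra. }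
  intros t; destruct (Rle_lt_dec t 0).
  - rewrite (U_0 v t), <- (U_0 v 0) by lra.
    apply Rle_trans with (u (0 + r)); [apply U_mono; lra|apply HI; unfold inI; lra].
  - destruct (Rle_lt_dec t 1); [apply HI; unfold inI; lra|].
    rewrite (U_1 v) by lra; apply U_range.
Qed.

(** * Suprema and infima in the unit interval *)

Lemma lubI_exists (T : R -> Prop) : {x | lubI (fun t => inI t /\ T t) x}.
Proof.
  (* Adjoining 0 makes the set nonempty, so the empty family gets supremum 0. *)
  destruct (completeness (fun t => t = 0 \/ (inI t /\ T t))) as [x [H1 H2]].
  - exists 1; intros t [->|[[? ?] ?]]; lra.
  - exists 0; auto.
  - exists x; split; [split|split].
    + apply H1; auto.
    + apply H2; intros t [->|[[? ?] ?]]; lra.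
    + intros t Ht; apply H1; auto.
    + intros y [Hy ?] Hub; apply H2; intros t [->|Ht]; [lra|auto].
Qed.

Definition supI (T : R -> Prop) : R := proj1_sig (lubI_exists T).

Lemma supI_lub T : lubI (fun t => inI t /\ T t) (supI T).
Proof. apply (proj2_sig (lubI_exists T)). Qed.

Lemma supI_range T : inI (supI T).
Proof. apply supI_lub. Qed.

Lemma supI_ub (T : R -> Prop) t : inI t -> T t -> t <= supI T.
Proof. intros; apply (supI_lub T); auto. Qed.

Lemma supI_gt (T : R -> Prop) y : 0 <= y -> y < supI T -> exists t, inI t /\ T t /\ y < t.
Proof.
  intros Hy H; apply NNPP; intros N.
  pose proof (supI_range T) as [? ?].
  enough (supI T <= y) by lra.
  apply (supI_lub T); [unfold inI; lra|]; intros t [Ht HT].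
  destruct (Rle_lt_dec t y); auto; exfalso; apply N; eauto.
Qed.

Lemma supI_least (T : R -> Prop) y :
  0 <= y -> (forall t, inI t -> T t -> t <= y) -> supI T <= y.
Proof.
  intros Hy H; destruct (Rle_lt_dec (supI T) y); auto.
  destruct (supI_gt T y) as [t [Ht [HT ?]]]; auto; pose proof (H t Ht HT); lra.
Qed.

Definition infI (T : R -> Prop) : R := supI (fun y => forall t, T t -> y <= t).

Lemma infI_glb (T : R -> Prop) : (forall t, T t -> inI t) -> glbI T (infI T).
Proof.
  intros HT; split; [apply supI_range|split].
  - intros t Ht; apply supI_least; [apply (HT t Ht)|auto].
  - intros y Hy H; apply supI_ub; auto.
Qed.

(** If [u (supI T)] were larger, an intermediate value [u z] would have [z < supI T], and an element
    of [T] above [z] contradicts this. The empty family is covered, since [u] fixes 0. *)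
Lemma U_supI (u : U) (T : R -> Prop) : u (supI T) = supI (fun y => exists t, inI t /\ T t /\ y = u t).
Proof.
  apply Rle_antisym.
  - destruct (Rle_lt_dec (u (supI T)) (supI (fun y => exists t, inI t /\ T t /\ y = u t)))
      as [|H]; auto.
    destruct (U_below u _ _ H) as [z [[Hz ?] [Hzs [Hlt _]]]]; [apply supI_range|].
    destruct (supI_gt T z Hz Hzs) as [t [Ht [HT Hzt]]].
    pose proof (U_mono u z t ltac:(lra)).
    pose proof (supI_ub (fun y => exists t, inI t /\ T t /\ y = u t) (u t) (U_range u t)
      (ex_intro _ t (conj Ht (conj HT eq_refl)))); lra.
  - apply supI_least; [apply U_range|]; intros y _ [t [Ht [HT ->]]].
    apply U_mono, supI_ub; auto.
Qed.

Lemma U_glbI (u : U) (T : R -> Prop) x : glbI T x -> glbI (image u T) (u x).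
Proof.
  intros [Hx [H1 H2]]; split; [apply U_range|split].
  - intros t [s [Hs ->]]; apply U_mono; auto.
  - intros y Hy H; destruct (Rle_lt_dec y (u x)) as [|Hlt]; auto.
    destruct (U_between u x y Hlt) as [z [Hz [Hxz [_ Hzy]]]]; [apply Hy|].
    enough (z <= x) by lra.
    apply H2; auto; intros t Ht; apply Rlt_le, (U_lt_inv u).
    pose proof (H (u t) ltac:(exists t; auto)); lra.
Qed.

Lemma glbI_unique (T T' : R -> Prop) x y :
  (forall t, T t <-> T' t) -> glbI T x -> glbI T' y -> x = y.
Proof.
  intros HT [Hx [H1 H2]] [Hy [H3 H4]]; apply Rle_antisym.
  - apply H4; auto; intros t Ht; apply H1, HT, Ht.
  - apply H2; auto; intros t Ht; apply H3, HT, Ht.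
Qed.

(** * Posets with joins dual to a sound doctrine *)

(** The full subset is only isomorphic to [X]; closure under cofinal subposets transfers
    membership. *)
Lemma inPhiX_full (Phi : PClass) (X : Poset) :
  is_join_doctrine Phi -> Phi X -> inPhiX Phi X (fun _ => True).
Proof.
  intros [_ [_ [_ H]]] HX; split; [intros ? ? ? ?; exact I|].
  apply H; auto; intros x; exists x; split; [exact I|apply le_refl].
Qed.

Lemma sound_dual_commute (Phi Psi : PClass) (X Y : Poset) (F : X -> Y -> Prop) :
  is_join_doctrine Phi -> is_join_doctrine Psi -> sound_dual Phi Psi -> Phi Y -> Psi X ->
  (forall x x' y y', le x' x -> le y y' -> F x y -> F x' y') ->
  (forall x, exists y, F x y) -> exists y, forall x, F x y.
Proof.
  intros HPhi HPsi [Hs _] HY HX HF H.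
  destruct (Hs X Y (fun _ => True) (fun _ => True) F) as [[y [_ Hy]] _]; auto.
  - apply inPhiX_full; auto.
  - apply inPhiX_full; auto.
  - intros x _; destruct (H x) as [y Hy]; eauto.
  - eauto.
Qed.

Section PsiIdeals.
Variables (Psi : PClass) (X : Poset).

Definition is_ideal (J : X -> Prop) : Prop :=
  lower X J /\
  forall S j, Psi (sub X S) -> is_lub X S j -> (forall x, S x -> J x) -> J j.

Definition ideal_gen (P : X -> Prop) : X -> Prop :=
  fun x => forall J, is_ideal J -> (forall y, P y -> J y) -> J x.

Lemma ideal_gen_ideal P : is_ideal (ideal_gen P).
Proof.
  split.
  - intros x y Hxy Hy J HJ HP; apply (proj1 HJ x y Hxy), Hy; auto.
  - intros S j HS Hj H J HJ HP; apply (proj2 HJ S j HS Hj).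
    intros x Hx; apply H; auto.
Qed.

Lemma ideal_gen_sub P x : P x -> ideal_gen P x.
Proof. intros Hx J _ H; auto. Qed.

Lemma ideal_gen_mono (P Q : X -> Prop) : (forall x, P x -> Q x) ->
  forall x, ideal_gen P x -> ideal_gen Q x.
Proof. intros H x Hx J HJ HQ; apply Hx; auto. Qed.

End PsiIdeals.

(* Soundness makes the operation of generating a Psi-ideal commute with
   Phi-unions, so the lower sets generating an ideal in Phi are closed under
   them and hence exhaust all lower sets. *)
Lemma joins_in_doctrine (Phi Psi : PClass) (X : Poset) :
  is_join_doctrine Phi -> is_join_doctrine Psi -> sound_dual Phi Psi ->
  (forall S, Psi (sub X S) -> exists j, is_lub X S j) -> Phi X.
Proof.
  intros HPhi HPsi Hs HX.
  pose proof HPhi as [Hunit [Hunion [Hcod _]]].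
  assert (H : lower X (fun _ => True) /\ Phi (sub X (ideal_gen Psi X (fun _ => True)))).
  { refine (proj2 Hs X (fun P => lower X P /\ Phi (sub X (ideal_gen Psi X P))) _ _ _ _ _).
    - intros P [? _]; auto.
    (* Here the generated ideal is the principal one below the join [j], so the one-element poset
       maps cofinally into it. *)
    - intros P [HP HPP]; split; auto.
      destruct (HX P HPP) as [j Hj].
      assert (Hj' : ideal_gen Psi X P j)
        by (apply (ideal_gen_ideal Psi X P) with P; auto using ideal_gen_sub).
      apply (Hcod unit_poset (sub X (ideal_gen Psi X P)) (fun _ => exist _ j Hj') Hunit).
      + intros ? ? _; apply le_refl.
      + intros [x Hx]; exists tt; simpl; apply Hx; [split|].
        * intros y z Hyz Hz; eapply le_trans; eauto.
        * intros S k _ [_ Hk]; apply Hk.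
        * apply Hj.
    - intros S HS HPS; split.
      { intros x y Hxy [P [HP Hy]]; exists P; split; auto; apply (proj1 (HS P HP) x y); auto. }
      (* The union of the generated ideals is itself closed under Psi-joins: if each member of a
         Psi-family lies in some ideal, soundness yields one ideal containing them all. *)
      assert (E : ideal_gen Psi X (bigU S) = bigU (image (ideal_gen Psi X) S)).
      { apply functional_extensionality; intros x; apply propositional_extensionality; split.
        - intros Hx; apply Hx; [split|].
          + intros y z Hyz [Q [[P [HP ->]] Hz]]; exists (ideal_gen Psi X P); split.
            * exists P; auto.
            * apply (proj1 (ideal_gen_ideal Psi X P) y z); auto.
          + intros S0 j HS0 Hj Hsub.
            destruct (sound_dual_commute Phi Psi (sub X S0) (sub (powerset X) S)
              (fun y P => ideal_gen Psi X (proj1_sig P) (proj1_sig y))) as [[P HP] H]; auto.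
            * intros y y' P P' Hy HPP' H.
              apply (proj1 (ideal_gen_ideal Psi X _) _ _ Hy).
              eapply ideal_gen_mono; [|apply H]; exact HPP'.
            * intros [y Hy]; destruct (Hsub y Hy) as [Q [[P [HP ->]] HQ]].
              exists (exist _ P HP); auto.
            * exists (ideal_gen Psi X P); split; [exists P; auto|].
              apply (proj2 (ideal_gen_ideal Psi X P) S0 j); auto.
              intros y Hy; apply (H (exist _ y Hy)).
          + intros y [P [HP Hy]]; exists (ideal_gen Psi X P); split; [exists P; auto|].
            apply ideal_gen_sub; auto.
        - intros [Q [[P [HP ->]] Hx]]; apply (ideal_gen_mono _ _ P); auto.
          intros y Hy; exists P; auto. }
      rewrite E; apply Hunion.
      + intros Q [P [HP ->]]; apply HS; auto.
      + apply (Hcod (sub (powerset X) S) (sub (powerset X) (image (ideal_gen Psi X) S))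
          (fun P => exist _ (ideal_gen Psi X (proj1_sig P))
                      (ex_intro _ (proj1_sig P) (conj (proj2_sig P) eq_refl)))); auto.
        * intros P P' HPP'; simpl; apply ideal_gen_mono; exact HPP'.
        * intros [Q [P [HP EQ]]]; exists (exist _ P HP); simpl; subst; auto.
    - intros ? ? ? ?; exact I. }
  (* The ideal generated by everything is all of [X], so its inclusion is cofinal. *)
  apply (Hcod (sub X (ideal_gen Psi X (fun _ => True))) X (fun x => proj1_sig x) (proj2 H)).
  - intros x y Hxy; exact Hxy.
  - intros x; unshelve eexists (exist _ x _); [apply ideal_gen_sub; exact I|apply le_refl].
Qed.

(** * Joins and meets of equivariant maps *)

Lemma is_lub_unique (X : Poset) (S : X -> Prop) j k : is_lub X S j -> is_lub X S k -> j = k.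
Proof. intros [H1 H2] [H3 H4]; apply le_antisym; auto. Qed.

Lemma is_glb_unique (X : Poset) (S : X -> Prop) j k : is_glb X S j -> is_glb X S k -> j = k.
Proof. intros [H1 H2] [H3 H4]; apply le_antisym; auto. Qed.

Section Maps.
Variables (Phi Psi : PClass) (A : UInfLat Psi).

Lemma UInf_range (f : UInfPoset A) a : inI (proj1_sig f a).
Proof. apply (proj2_sig f). Qed.

Lemma UInf_mono (f : UInfPoset A) a b : le a b -> proj1_sig f a <= proj1_sig f b.
Proof. apply (proj2_sig f). Qed.

Lemma UInf_act (f : UInfPoset A) u a : proj1_sig f (act A u a) = u (proj1_sig f a).
Proof. apply (proj2_sig f). Qed.

Lemma UInf_meets (f : UInfPoset A) S m : Psi (opp (sub A S)) -> is_glb A S m ->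
  glbI (image (proj1_sig f) S) (proj1_sig f m).
Proof. apply (proj2_sig f). Qed.

(** The pointwise supremum works: elements of [U] preserve suprema, and soundness lets Phi-suprema
    commute with Psi^op-infima. *)
Lemma UInf_join_exists (S : UInfPoset A -> Prop) :
  is_join_doctrine Phi -> is_join_doctrine Psi -> sound_dual Phi Psi ->
  Phi (sub (UInfPoset A) S) ->
  exists j, is_lub (UInfPoset A) S j /\ forall c, lubI (image (iota A c) S) (proj1_sig j c).
Proof.
  intros HPhi HPsi Hs HS.
  set (h := fun c => supI (image (iota A c) S)).
  assert (Hub : forall f c, S f -> proj1_sig f c <= h c).
  { intros f c Hf; apply supI_ub; [apply UInf_range|exists f; auto]. }
  assert (Hl : forall c y, 0 <= y -> (forall f, S f -> proj1_sig f c <= y) -> h c <= y).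
  { intros c y Hy H; apply supI_least; auto; intros t _ [f [Hf ->]]; apply H, Hf. }
  assert (Hh : is_UInf A h).
  { split; [intros; apply supI_range|split; [|split]].
    - intros a b Hab; apply Hl; [apply supI_range|]; intros f Hf.
      eapply Rle_trans; [apply UInf_mono, Hab|auto].
    - intros u a; unfold h; rewrite U_supI; f_equal.
      apply functional_extensionality; intros y; apply propositional_extensionality; split.
      + intros [f [Hf ->]]; exists (proj1_sig f a); split; [apply UInf_range|].
        split; [exists f; auto|apply UInf_act].
      + intros [t [_ [[f [Hf ->]] ->]]]; exists f; split; auto; symmetry; apply UInf_act.
    - intros T m HT Hm; split; [apply supI_range|split].
      + intros t [c [Hc ->]]; apply Hl; [apply supI_range|]; intros f Hf.
        eapply Rle_trans; [apply UInf_mono, (proj1 Hm c Hc)|auto].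
      + intros y [Hy0 Hy1] H; destruct (Rle_lt_dec y (h m)) as [|Hlt]; auto; exfalso.
        assert (Hm0 : 0 <= h m) by apply supI_range.
        (* Soundness is two-valued, so it is applied at a threshold halfway between [h m] and [y]:
           one [f] exceeds it on all of [T], hence is at least the threshold at [m], above [h m]. *)
        destruct (sound_dual_commute Phi Psi (opp (sub A T)) (sub (UInfPoset A) S)
          (fun c f => (h m + y) / 2 < proj1_sig (proj1_sig f) (proj1_sig c)))
          as [[f Hf] Hc]; auto.
        * intros c c' f f' Hc Hf H'; eapply Rlt_le_trans; [apply H'|].
          eapply Rle_trans; [apply UInf_mono, Hc|apply Hf].
        * intros [c Hc]; pose proof (H (h c) ltac:(exists c; auto)).
          destruct (supI_gt (image (iota A c) S) ((h m + y) / 2)) as [t [_ [[f [Hf ->]] Ht]]];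
            [lra|fold (h c); lra|].
          exists (exist _ f Hf); exact Ht.
        * enough ((h m + y) / 2 <= proj1_sig f m) by (pose proof (Hub f m Hf); lra).
          apply (UInf_meets f T m HT Hm); [unfold inI; lra|].
          intros t [c [HTc ->]]; apply Rlt_le, (Hc (exist _ c HTc)). }
  exists (exist _ h Hh); split; [split|].
  - intros f Hf c; apply Hub, Hf.
  - intros f Hf c; apply Hl; [apply UInf_range|]; intros f' Hf'; apply (Hf f' Hf').
  - intros c; split; [apply supI_range|split].
    + intros t [f [Hf ->]]; apply Hub, Hf.
    + intros y [Hy _] H; apply Hl; auto; intros f Hf; apply H; exists f; auto.
Qed.

Lemma UInf_meet_exists (S : UInfPoset A -> Prop) :
  exists m, is_glb (UInfPoset A) S m /\ forall c, glbI (image (iota A c) S) (proj1_sig m c).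
Proof.
  set (h := fun c => infI (image (iota A c) S)).
  assert (Hg : forall c, glbI (image (iota A c) S) (h c)).
  { intros c; apply infI_glb; intros t [f [_ ->]]; apply UInf_range. }
  assert (Hlb : forall f c, S f -> h c <= proj1_sig f c).
  { intros f c Hf; apply (Hg c); exists f; auto. }
  assert (Hl : forall c y, inI y -> (forall f, S f -> y <= proj1_sig f c) -> y <= h c).
  { intros c y Hy H; apply (Hg c); auto; intros t [f [Hf ->]]; apply H, Hf. }
  assert (Hh : is_UInf A h).
  { split; [intros c; apply (Hg c)|split; [|split]].
    - intros a b Hab; apply Hl; [apply (Hg a)|]; intros f Hf.
      eapply Rle_trans; [apply Hlb, Hf|apply UInf_mono, Hab].
    - intros u a; eapply glbI_unique; [|apply Hg|apply (U_glbI u _ _ (Hg a))].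
      intros t; split.
      + intros [f [Hf ->]]; exists (proj1_sig f a); split; [exists f; auto|apply UInf_act].
      + intros [s [[f [Hf ->]] ->]]; exists f; split; auto; symmetry; apply UInf_act.
    - intros T m HT Hm; split; [apply (Hg m)|split].
      + intros t [c [Hc ->]]; apply Hl; [apply (Hg m)|]; intros f Hf.
        eapply Rle_trans; [apply Hlb, Hf|apply UInf_mono, (proj1 Hm c Hc)].
      + intros y Hy H; apply Hl; auto; intros f Hf.
        apply (UInf_meets f T m HT Hm); auto; intros t [c [Hc ->]].
        eapply Rle_trans; [apply H; exists c; auto|auto]. }
  exists (exist _ h Hh); split; [split|exact Hg].
  - intros f Hf c; apply Hlb, Hf.
  - intros f Hf c; apply Hl; [apply UInf_range|]; intros f' Hf'; apply (Hf f' Hf').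
Qed.

(** Meets and Phi-joins of maps are computed pointwise, so evaluation preserves them. *)
Lemma iota_PhiCtsHom a :
  is_join_doctrine Phi -> is_join_doctrine Psi -> sound_dual Phi Psi ->
  is_PhiCtsHom Phi (UInfPoset A) (iota A a).
Proof.
  intros HPhi HPsi Hs; split; [intros f; apply UInf_range|split].
  - intros S m Hm; destruct (UInf_meet_exists S) as [m' [Hm' H]].
    rewrite (is_glb_unique _ _ _ _ Hm Hm'); apply H.
  - intros S j HS Hj; destruct (UInf_join_exists S HPhi HPsi Hs HS) as [j' [Hj' H]].
    rewrite (is_lub_unique _ _ _ _ Hj Hj'); apply H.
Qed.

End Maps.

(** * Cuts *)

(* Reads as: if [a > x] then [c >= y]. *)
Definition cut_le {A : UPoset} (a : A) (x : R) (c : A) (y : R) : Prop :=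
  forall u v : U, u x = 0 -> v y = 1 -> le (act A u a) (act A v c).

Section Cuts.
Variable A : UPoset.

Lemma act_comp_le_l (u v : U) (w : U) (a c : A) :
  (forall t, u (v t) <= w t) -> le c (act A u (act A v a)) -> le c (act A w a).
Proof.
  intros H Hc; destruct (U_comp u v) as [k Hk].
  eapply le_trans; [apply Hc|].
  rewrite <- (act_comp A u v k a) by auto.
  apply act_mono_l; intros t _; rewrite Hk; apply H.
Qed.

Lemma cut_le_weaken (a b c d : A) x y y' :
  le b a -> le c d -> y' <= y -> cut_le a x c y -> cut_le b x d y'.
Proof.
  intros Hab Hcd Hy H u v Hu Hv.
  eapply le_trans; [apply act_mono_r, Hab|].
  eapply le_trans; [apply (H u v Hu)|apply act_mono_r, Hcd].
  pose proof (U_mono v y' y Hy); pose proof (U_range v y) as [? ?]; lra.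
Qed.

Lemma cut_le_act (w : U) (a c : A) x y : cut_le a x c y -> cut_le a x (act A w c) (w y).
Proof.
  intros H u v Hu Hv; destruct (U_comp v w) as [k Hk].
  rewrite <- (act_comp A v w k c) by auto; apply H; auto; rewrite Hk; auto.
Qed.

(** A ramp [v0] rising between [w z] and [y] satisfies [v0 (w t) <= v t], because [v] is already 1
    at [z]. *)
Lemma cut_le_act_inv (w : U) (a c : A) x y z :
  y <= 1 -> w z < y -> cut_le a x (act A w c) y -> cut_le a x c z.
Proof.
  intros Hy Hz H u v Hu Hv; pose proof (U_range w z) as [? _].
  destruct (U_ramp (w z) y) as [v0 [Hv0 [Hv1 _]]]; auto.
  apply (act_comp_le_l v0 w v c).
  - intros t; destruct (Rle_lt_dec t z) as [Ht|Ht].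
    + rewrite Hv0 by (apply U_mono; auto); apply U_range.
    + eapply Rle_trans; [apply U_range|]; rewrite <- Hv; apply U_mono; lra.
  - apply H; auto; apply Hv1; lra.
Qed.

(** Pointwise [u (w t) <= v t]: up to [y] the left side is 0, and from [y] on the right side is
    1. *)
Lemma cut_le_unit (w : U) (a : A) x y : w y <= x -> cut_le (act A w a) x a y.
Proof.
  intros Hw u v Hu Hv; destruct (U_comp u w) as [k Hk].
  rewrite <- (act_comp A u w k a) by auto.
  apply act_mono_l; intros t _; rewrite Hk; destruct (Rle_lt_dec t y) as [Ht|Ht].
  - pose proof (U_mono u (w t) x); pose proof (U_mono w t y Ht).
    pose proof (U_range v t) as [? _]; lra.
  - pose proof (U_mono v y t ltac:(lra)); pose proof (U_range u (w t)) as [_ ?]; lra.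
Qed.

(* The interval on which [u] rises from 0 to 1 is cut into pieces of length
   [r/2]; unstackability reduces the claim to each piece, and there [v] reaches 1
   at least [r/2] before [u] leaves 0. *)
Lemma le_of_cut_le_subdivided (a b : A) : unstackable A ->
  (forall x y, y < x -> cut_le a x b y) ->
  forall r, 0 < r -> forall n p (u v : U),
  (forall t, u (t + r) <= v t) -> u p = 0 -> u (p + INR n * (r / 2)) = 1 ->
  le (act A u a) (act A v b).
Proof.
  intros HU H r Hr n; induction n as [|n IH]; intros p u v Huv Hp Hq.
  - simpl in Hq; rewrite Rmult_0_l, Rplus_0_r in Hq; lra.
  - rewrite S_INR in Hq.
    replace (p + (INR n + 1) * (r / 2)) with ((p + r / 2) + INR n * (r / 2)) in Hq by lra.
    assert (Hfirst : forall u v : U, (forall t, u (t + r) <= v t) -> u p = 0 ->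
      u (p + r / 2) = 1 -> le (act A u a) (act A v b)).
    { intros u' v' Huv' Hp' Hq'; apply (H p (p - r / 2)); [lra|auto|].
      pose proof (Huv' (p - r / 2)) as K.
      replace (p - r / 2 + r) with (p + r / 2) in K by lra.
      pose proof (U_range v' (p - r / 2)) as [? ?]; lra. }
    (* The height reached by [u] after the first piece is where unstackability splits; heights 0 and
       1 leave only one piece to treat. *)
    pose proof (U_range u (p + r / 2)) as [[Hy0|Hy0] [Hy1|Hy1]];
      [|apply Hfirst; auto|apply (IH (p + r / 2)); auto|exfalso; lra].
    set (y := u (p + r / 2)) in *.
    destruct (U_ramp_initial y) as [w1 [I1 [W1 _]]]; [lra|].
    destruct (U_ramp_final y) as [w2 [I2 [W2 _]]]; [lra|].
    assert (Hcomp : forall w : U, exists wu wv : U,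
      (forall t, wu t = w (u t)) /\ (forall t, wu (t + r) <= wv t) /\
      act A w (act A u a) = act A wu a /\ act A w (act A v b) = act A wv b).
    { intros w; destruct (U_comp w u) as [wu Hwu]; destruct (U_comp w v) as [wv Hwv].
      exists wu, wv; split; auto; split; [|split].
      - intros t; rewrite Hwu, Hwv; apply U_mono, Huv.
      - symmetry; apply act_comp; auto.
      - symmetry; apply act_comp; auto. }
    apply (HU y w1 w2); auto.
    + destruct (Hcomp w1) as [wu [wv [Hwu [Hle [-> ->]]]]].
      apply Hfirst; auto; rewrite Hwu; [rewrite Hp; apply U_0|apply W1]; apply Rle_refl.
    + destruct (Hcomp w2) as [wu [wv [Hwu [Hle [-> ->]]]]].
      apply (IH (p + r / 2)); auto; rewrite Hwu; [apply W2, Rle_refl|].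
      rewrite Hq; apply U_1; lra.
Qed.

(** The Archimedean property provides a gap [r]; finitely many pieces of length [r/2] starting at 0
    pass beyond 1. *)
Lemma le_of_cut_le (a b : A) : archimedean A -> unstackable A ->
  (forall x y, y < x -> cut_le a x b y) -> le a b.
Proof.
  intros HA HU H; apply HA; intros r Hr u v Huv.
  destruct (INR_archimed (r / 2) 1) as [n Hn]; [lra|].
  apply (le_of_cut_le_subdivided a b HU H r Hr n 0).
  - apply U_trunc_add_le; auto; lra.
  - apply U_0; lra.
  - apply U_1; lra.
Qed.

End Cuts.

(** * Separating maps obtained from cuts *)

Section CutMaps.
Variables (Psi : PClass) (A : UInfLat Psi).

Definition cut_fun (a : A) (x : R) (c : A) : R := supI (cut_le a x c).

(** For fixed [y] the cut is a conjunction of inequalities [act u a <= act v c], and each [v]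
    preserves Psi^op-meets in [c]. Equivariance combines [cut_le_act] with its partial inverse. *)
Lemma cut_fun_UInf a x : is_UInf A (cut_fun a x).
Proof.
  split; [intros; apply supI_range|split; [|split]].
  - intros c d Hcd; apply supI_least; [apply supI_range|]; intros y Hy H.
    apply supI_ub; auto; eapply cut_le_weaken; [apply le_refl|apply Hcd|apply Rle_refl|apply H].
  - intros w c; apply Rle_antisym.
    + apply supI_least; [apply U_range|]; intros y Hy H.
      destruct (Rle_lt_dec y (w (cut_fun a x c))) as [|Hlt]; auto; exfalso.
      destruct (U_between w _ _ Hlt) as [z [Hz [Hlt' [_ Hzy]]]]; [apply Hy|].
      enough (z <= cut_fun a x c) by lra.
      apply supI_ub; auto; apply (cut_le_act_inv A w a c x y z); auto; apply Hy.
    + unfold cut_fun at 1; rewrite U_supI; apply supI_least; [apply supI_range|].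
      intros y Hy [t [Ht [H ->]]]; apply supI_ub; auto; apply cut_le_act, H.
  - intros S m HS Hm; split; [apply supI_range|split].
    + intros t [c [Hc ->]]; apply supI_least; [apply supI_range|]; intros y Hy H.
      apply supI_ub; auto.
      eapply cut_le_weaken; [apply le_refl|apply Hm, Hc|apply Rle_refl|apply H].
    + intros y [Hy0 Hy1] H; destruct (Rle_lt_dec y (cut_fun a x m)) as [|Hlt]; auto; exfalso.
      assert (Hm0 : 0 <= cut_fun a x m) by apply supI_range.
      set (z := (cut_fun a x m + y) / 2).
      assert (Hz : cut_fun a x m < z < y) by (unfold z; lra).
      enough (z <= cut_fun a x m) by lra.
      apply supI_ub; [unfold inI; lra|]; intros u v Hu Hv.
      apply (act_pres_meets Psi A v S m HS Hm); intros s [c [Hc ->]].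
      pose proof (H (cut_fun a x c) ltac:(exists c; auto)).
      destruct (supI_gt (cut_le a x c) z) as [t [_ [Ht Hzt]]];
        [lra|fold (cut_fun a x c); lra|].
      apply Ht; auto.
      pose proof (U_mono v z t ltac:(lra)); pose proof (U_range v t) as [_ ?]; lra.
Qed.

Definition cut_map (a : A) (x : R) : UInfPoset A := exist _ (cut_fun a x) (cut_fun_UInf a x).

Lemma cut_map_antitone a b x : le b a -> le (cut_map a x) (cut_map b x).
Proof.
  intros Hba c; apply supI_least; [apply supI_range|]; intros y Hy H.
  apply supI_ub; auto; eapply cut_le_weaken; [apply Hba|apply le_refl|apply Rle_refl|apply H].
Qed.

(** If [f c < y], take a ramp from [x] to [f a] and one from [f c] to [y]: applying [f] to the
    resulting inequality gives [1 <= 0]. *)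
Lemma cut_map_le (f : UInfPoset A) a x : 0 <= x < proj1_sig f a -> le (cut_map a x) f.
Proof.
  intros Hx c; apply supI_least; [apply UInf_range|]; intros y [Hy0 Hy1] H.
  destruct (Rle_lt_dec y (proj1_sig f c)) as [|Hlt]; auto; exfalso.
  pose proof (UInf_range _ A f a) as [_ ?]; pose proof (UInf_range _ A f c) as [? _].
  destruct (U_ramp x (proj1_sig f a)) as [u [Hu [Hu1 _]]]; try lra.
  destruct (U_ramp (proj1_sig f c) y) as [v [Hv [Hv1 _]]]; try lra.
  pose proof (H u v (Hu _ (Rle_refl _)) (Hv1 _ (Rle_refl _))) as K.
  apply (UInf_mono _ A f) in K; rewrite !UInf_act, Hu1, Hv in K; lra.
Qed.

Lemma iota_reflects_le (a b : A) : archimedean A -> unstackable A ->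
  (forall f : UInfPoset A, proj1_sig f a <= proj1_sig f b) -> le a b.
Proof.
  intros HA HU H; apply le_of_cut_le; auto; intros x y Hyx.
  (* For [x >= 1] or [y <= 0] the cut is vacuous, as elements of [U] fix 0 and 1. *)
  destruct (Rle_lt_dec 1 x) as [Hx|Hx]; [intros u v Hu; rewrite U_1 in Hu; lra|].
  destruct (Rle_lt_dec y 0) as [Hy|Hy]; [intros u v _ Hv; rewrite U_0 in Hv; lra|].
  assert (Hxa : x <= cut_fun a x a).
  { apply supI_ub; [unfold inI; lra|]; intros u v Hu Hv.
    apply act_mono_l; intros t _; destruct (Rle_lt_dec t x) as [Ht|Ht].
    - pose proof (U_mono u t x Ht); pose proof (U_range v t) as [? _]; lra.
    - pose proof (U_mono v x t ltac:(lra)); pose proof (U_range u t) as [_ ?].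
      lra. }
  pose proof (H (cut_map a x)) as K; simpl in K.
  destruct (supI_gt (cut_le a x b) y) as [t [_ [Ht Hyt]]];
    [lra|fold (cut_fun a x b); lra|].
  eapply cut_le_weaken; [apply le_refl|apply le_refl|apply Rlt_le, Hyt|apply Ht].
Qed.

End CutMaps.
Arguments cut_map {Psi A} _ _.

(** * Density *)

(** When [f <= h], [f] is the meet of the pair [f], [h], and [g] preserves it. *)
Lemma PhiCtsHom_mono (Phi : PClass) (Y : Poset) (g : Y -> R) (f h : Y) :
  is_PhiCtsHom Phi Y g -> le f h -> g f <= g h.
Proof.
  intros [_ [Hg _]] Hfh.
  apply (Hg (fun k => k = f \/ k = h) f).
  - split; [intros k [->| ->]; [apply le_refl|auto]|auto].
  - exists h; auto.
Qed.

Section Density.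
Variables (Phi Psi : PClass) (A : UInfLat Psi) (g : UInfPoset A -> R).
Hypotheses (HPhi : is_join_doctrine Phi) (HPsi : is_join_doctrine Psi).
Hypotheses (Hsound : sound_dual Phi Psi) (Hg : is_PhiCtsHom Phi (UInfPoset A) g).

(** The filter is closed under Psi^op-meets, so its opposite has all Psi-joins and
    [joins_in_doctrine] applies. *)
Lemma filter_in_doctrine (f : UInfPoset A) :
  Phi (opp (sub A (fun a => proj1_sig f a = 1))).
Proof.
  apply (joins_in_doctrine Phi Psi); auto; intros S HS.
  set (F := fun a => proj1_sig f a = 1).
  set (S' := fun a => exists h : F a, S (exist _ a h)).
  assert (HS' : Psi (opp (sub A S'))).
  { pose proof HPsi as [_ [_ [Hcod _]]].
    apply (Hcod (sub (opp (sub A F)) S) (opp (sub A S'))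
      (fun x => exist S' (proj1_sig (proj1_sig x))
        match x with exist (exist a h) H => ex_intro _ h H end)); auto.
    - intros [[a Ha] Ha'] [[b Hb] Hb'] Hab; exact Hab.
    - intros [a [h H]]; exists (exist _ (exist _ a h) H); apply le_refl. }
  destruct (has_meets Psi A S' HS') as [m Hm].
  assert (Fm : F m).
  { pose proof (UInf_range _ A f m) as [_ ?]; unfold F; apply Rle_antisym; auto.
    apply (UInf_meets _ A f S' m HS' Hm); [unfold inI; lra|].
    intros t [a [[h _] ->]]; unfold F in h; lra. }
  exists (exist _ m Fm); split.
  - intros [a h] Ha; apply Hm; exists h; auto.
  - intros [b Hb] H; apply Hm; intros a [h Ha]; apply (H (exist _ a h) Ha).
Qed.

(* With [mt] the least map where [g] is at least [t], the maps [cut_map a (1/2)]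
   for [mt a = 1] form a family in Phi whose join dominates [mt]; so [g]
   exceeds [s] at one of them. *)
Lemma PhiCtsHom_level s t : 0 <= s -> s < t -> t <= 1 ->
  exists a : A, forall f : UInfPoset A,
    (t <= g f -> proj1_sig f a = 1) /\ (0 < proj1_sig f a -> s < g f).
Proof.
  intros Hs Hst Ht; pose proof Hg as [Hg0 [Hg1 Hg2]].
  destruct (UInf_meet_exists Psi A (fun f => t <= g f)) as [mt [Hmt _]].
  assert (Hgmt : t <= g mt).
  { apply (Hg1 _ _ Hmt); [unfold inI; lra|]; intros y [f [Hf ->]]; auto. }
  set (F := fun a => proj1_sig mt a = 1).
  set (K := fun f => exists a, F a /\ f = cut_map a (1 / 2)).
  assert (HK : Phi (sub (UInfPoset A) K)).
  { pose proof HPhi as [_ [_ [Hcod _]]].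
    apply (Hcod (opp (sub A F)) (sub (UInfPoset A) K)
      (fun a => exist K (cut_map (proj1_sig a) (1 / 2))
        (ex_intro _ (proj1_sig a) (conj (proj2_sig a) eq_refl)))).
    - apply filter_in_doctrine.
    - intros a b Hab; apply cut_map_antitone, Hab.
    - intros [f [a [Ha E]]]; exists (exist _ a Ha); simpl; rewrite E; intros c; apply Rle_refl. }
  destruct (UInf_join_exists Phi Psi A K HPhi HPsi Hsound HK) as [j [Hj Hjc]].
  assert (Hmj : le mt j).
  (* The ramp [w] from [y] to [mt c] moves [c] into the filter, and since [w y = 0 <= 1/2] the cut
     map of [act A w c] is at least [y] at [c]. *)
  { intros c; destruct (Rle_lt_dec (proj1_sig mt c) (proj1_sig j c)) as [|Hlt]; auto; exfalso.
    pose proof (UInf_range _ A j c) as [? _]; pose proof (UInf_range _ A mt c) as [_ ?].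
    set (y := (proj1_sig j c + proj1_sig mt c) / 2).
    assert (Hy : proj1_sig j c < y < proj1_sig mt c) by (unfold y; lra).
    destruct (U_ramp y (proj1_sig mt c)) as [w [Hw0 [Hw1 _]]]; try lra.
    enough (y <= proj1_sig j c) by lra.
    apply Rle_trans with (cut_fun Psi A (act A w c) (1 / 2) c).
    - apply supI_ub; [unfold inI; lra|]; apply cut_le_unit; rewrite Hw0; lra.
    - apply (proj1 Hj (cut_map (act A w c) (1 / 2))); exists (act A w c); split; auto.
      unfold F; rewrite UInf_act; apply Hw1; lra. }
  assert (Ha : exists a, F a /\ s < g (cut_map a (1 / 2))).
  { apply NNPP; intros N; pose proof (PhiCtsHom_mono Phi _ g _ _ Hg Hmj).
    enough (g j <= s) by lra.
    apply (Hg2 K j HK Hj); [unfold inI; lra|]; intros y [f [[a [Ha ->]] ->]].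
    destruct (Rle_lt_dec (g (cut_map a (1 / 2))) s); auto; exfalso; eauto. }
  destruct Ha as [a [Fa Ha]].
  (* This ramp keeps the value 1 and is positive only above 1/2, where [cut_map_le] puts the cut map
     below [f]. *)
  destruct (U_ramp (1 / 2) 1) as [w [Hw0 [Hw1 _]]]; try lra.
  exists (act A w a); intros f; rewrite UInf_act; split.
  - intros Hf; apply Hw1; rewrite <- Fa; apply (proj1 Hmt f Hf).
  - intros Hf; eapply Rlt_le_trans; [apply Ha|].
    apply (PhiCtsHom_mono Phi _ g); auto; apply cut_map_le; split; [lra|].
    destruct (Rle_lt_dec (proj1_sig f a) (1 / 2)) as [Hle|]; auto; rewrite Hw0 in Hf; lra.
Qed.

Lemma PhiCtsHom_level_nat N k : (k < N)%nat ->
  exists a : A, forall f : UInfPoset A,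
    (INR k + 1 <= INR N * g f -> proj1_sig f a = 1) /\
    (0 < proj1_sig f a -> INR k < INR N * g f).
Proof.
  intros H; pose proof (pos_INR k); pose proof (le_INR (S k) N H) as HkN.
  rewrite S_INR in HkN.
  destruct (PhiCtsHom_level (INR k / INR N) ((INR k + 1) / INR N)) as [a Ha].
  - apply Rle_div_r; lra.
  - apply Rmult_lt_compat_r; [apply Rinv_0_lt_compat|]; lra.
  - apply Rle_div_l; lra.
  - exists a; intros f; destruct (Ha f) as [H1 H2]; split; intros Hf.
    + apply H1, Rle_div_l; lra.
    + specialize (H2 Hf); apply Rlt_div_l in H2; lra.
Qed.

(* Stacking over [n/(n+1)] averages: [(n+1) f(c') = n f(c) + f(a)]. *)
Lemma PhiCtsHom_approx_steps N : archimedean A -> stackable A ->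
  forall n, (n < N)%nat -> exists c : A, forall f : UInfPoset A,
    (INR (S n) <= INR N * g f -> proj1_sig f c = 1) /\
    Rabs (INR (S n) * proj1_sig f c - Rmin (INR (S n)) (INR N * g f)) <= 1.
Proof.
  intros HA [HU HS] n; induction n as [|n IH]; intros Hn.
  - destruct (PhiCtsHom_level_nat N 0 Hn) as [a Ha]; exists a; intros f; destruct (Ha f) as [H1 _]; simpl in *.
    split; [intros; apply H1; lra|].
    pose proof (UInf_range _ A f a) as [? ?]; pose proof (proj1 Hg f) as [? ?].
    assert (0 <= INR N * g f) by (apply Rmult_le_pos; [apply pos_INR|auto]).
    apply Rabs_le; unfold Rmin; destruct (Rle_dec 1 (INR N * g f)); lra.
  - destruct (PhiCtsHom_level_nat N (S n) Hn) as [a Ha]; destruct IH as [c Hc]; [lia|].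
    set (k := INR (S n)) in *; assert (Hk : 1 <= k).
    { unfold k; rewrite S_INR; pose proof (pos_INR n); lra. }
    set (r := k / (k + 1)).
    assert (Hkr : r * (k + 1) = k) by (unfold r; field; lra).
    assert (Hr : 0 < r < 1).
    { split; [apply Rdiv_lt_0_compat|apply Rlt_div_l]; lra. }
    destruct (U_ramp_initial r Hr) as [u [Iu [Hu1 Hu]]].
    destruct (U_ramp_final r Hr) as [v [Iv [Hv1 Hv]]].
    destruct (HS r u v Hr Iu Iv c a) as [d [Hd1 Hd2]].
    (* The layers are nested: where [f a > 0] the scaled value [INR N * g f] exceeds [k], so
       [f c = 1] already. *)
    { intros u' v'; apply iota_reflects_le; auto; intros f; rewrite !UInf_act.
      pose proof (UInf_range _ A f a) as [[Hp|Hp] _].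
      - rewrite (proj1 (Hc f)), (U_1 u' 1); [apply U_range|lra|].
        apply Rlt_le, (Ha f), Hp.
      - rewrite <- Hp, U_0 by lra; apply U_range. }
    exists d; intros f; rewrite S_INR; fold k.
    assert (E : (k + 1) * proj1_sig f d = k * proj1_sig f c + proj1_sig f a).
    { rewrite <- Hd1, <- Hd2, !UInf_act; pose proof (UInf_range _ A f d) as [? ?].
      destruct (Rle_lt_dec (proj1_sig f d) r) as [Hle|Hlt].
      - rewrite (Hv1 _ Hle); pose proof (Hu (proj1_sig f d) ltac:(lra)); nra.
      - rewrite (Hu1 (proj1_sig f d)) by lra; pose proof (Hv (proj1_sig f d) ltac:(lra)); nra. }
    destruct (Ha f) as [Ha1 Ha2]; destruct (Hc f) as [Hc1 Hc2].
    pose proof (UInf_range _ A f a) as [? ?].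
    split.
    + intros Hf; rewrite Ha1, Hc1 in E by lra; nra.
    (* The error does not accumulate, since at most one layer is inexact: either [f a = 0], or
       [f c = 1] and only [f a] contributes. *)
    + rewrite E; clear E; destruct (Rle_lt_dec (INR N * g f) k) as [Hle|Hlt].
      * assert (proj1_sig f a = 0) as ->
          by (destruct (Rle_lt_dec (proj1_sig f a) 0) as [|Hp]; [lra|specialize (Ha2 Hp); lra]).
        rewrite Rmin_right in * by lra; rewrite Rplus_0_r; exact Hc2.
      * rewrite Hc1 by lra; destruct (Rle_lt_dec (k + 1) (INR N * g f)) as [Hle'|Hlt'].
        -- rewrite Ha1, Rmin_left by lra; apply Rabs_le; lra.
        -- rewrite Rmin_right by lra; apply Rabs_le; lra.
Qed.

Lemma iota_dense_uniform : archimedean A -> stackable A -> forall eps, 0 < eps ->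
  exists a : A, forall f : UInfPoset A, Rabs (proj1_sig f a - g f) <= eps.
Proof.
  intros HA HS eps Heps.
  destruct (INR_archimed eps 1 Heps) as [N HN].
  destruct N as [|n]; [simpl in HN; lra|].
  (* With all [S n] layers stacked the minimum is [INR (S n) * g f], so dividing leaves an error of
     at most [1 / INR (S n) < eps]. *)
  destruct (PhiCtsHom_approx_steps (S n) HA HS n) as [c Hc]; [lia|].
  exists c; intros f; destruct (Hc f) as [_ H].
  set (k := INR (S n)) in *; assert (Hk : 1 <= k).
  { unfold k; rewrite S_INR; pose proof (pos_INR n); lra. }
  pose proof (proj1 Hg f) as [? ?].
  rewrite Rmin_right in H by nra.
  apply Rabs_le_between in H; apply Rabs_le; split; nra.
Qed.

End Density.

(** * The metric *)

Section Metric.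
Variables (X : Type) (leX : X -> X -> Prop) (actX : U -> X -> X).

(** Vacuous: at [t = 0] the condition on [u], [v] would read [1 <= 0]. Hence the infimum defining
    [rho] is over a nonempty set. *)
Lemma le_r_1 a b : le_r leX actX 1 a b.
Proof.
  intros u v H; specialize (H 0); unfold trunc_add in H.
  rewrite Rplus_0_l, Rmin_left, U_1, U_0 in H by lra.
  assert (1 <= 0) by (apply H; unfold inI; lra); lra.
Qed.

Lemma rho_glb a b :
  is_glb_Rbar (fun r => 0 <= r /\ le_r leX actX r a b) (rho leX actX a b).
Proof.
  unfold rho; set (E := fun r => 0 <= r /\ le_r leX actX r a b).
  pose proof (Glb_Rbar_correct E) as [H1 H2].
  (* The member 1 and the lower bound 0 make the extended infimum finite, so [real] does not alter
     it. *)
  assert (E1 : E 1) by (split; [lra|apply le_r_1]).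
  pose proof (H1 1 E1) as K1.
  pose proof (H2 0 ltac:(intros r [Hr _]; exact Hr)) as K0.
  split; destruct (Glb_Rbar E); auto; contradiction.
Qed.

Lemma rho_le r a b : 0 <= r -> le_r leX actX r a b -> rho leX actX a b <= r.
Proof. intros Hr H; apply (proj1 (rho_glb a b) r); auto. Qed.

Lemma rho_lt e a b : rho leX actX a b < e -> exists r, 0 <= r < e /\ le_r leX actX r a b.
Proof.
  intros H; apply NNPP; intros N.
  enough (e <= rho leX actX a b) by lra.
  apply (proj2 (rho_glb a b) e); intros r [Hr Hle]; simpl.
  destruct (Rle_lt_dec e r) as [|Hlt]; auto; exfalso; eauto.
Qed.

End Metric.

(** * Shifts on the unit interval and the uniform metric *)

Lemma U_le_of_shift (u v : U) r x y : 0 <= r -> x <= y + r ->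
  (forall t, inI t -> u (trunc_add t r) <= v t) -> u x <= v y.
Proof.
  intros Hr Hxy H; eapply Rle_trans; [apply U_mono, Hxy|apply U_trunc_add_le; auto].
Qed.

(** The ramps over [[y + r, x]] and [[y, x - r]] are translates of each other by [r], yet take the
    values 1 at [x] and 0 at [y]. *)
Lemma shift_of_U_le r x y : 0 <= r -> inI x -> inI y ->
  (forall u v : U, (forall t, inI t -> u (trunc_add t r) <= v t) -> u x <= v y) -> x <= y + r.
Proof.
  intros Hr [Hx0 Hx1] [Hy0 Hy1] H; destruct (Rle_lt_dec x (y + r)) as [|Hlt]; auto; exfalso.
  destruct (U_ramp (y + r) x) as [u [Hu0 [Hu1 Hu]]]; try lra.
  destruct (U_ramp y (x - r)) as [v [Hv0 [Hv1 Hv]]]; try lra.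
  enough (K : u x <= v y) by (rewrite Hu1, Hv0 in K; lra).
  apply H; intros t [Ht0 Ht1]; unfold trunc_add.
  apply Rle_trans with (u (t + r)); [apply U_mono, Rmin_l|].
  destruct (Rle_lt_dec t y); [rewrite Hu0 by lra; apply U_range|].
  destruct (Rle_lt_dec (x - r) t); [rewrite Hv1 by lra; apply U_range|].
  rewrite Hu, Hv by lra; apply Req_le; field; lra.
Qed.

Lemma cod_udist_le (Y : Type) (g h : Y -> R) r : 0 <= r ->
  (forall y, Rabs (g y - h y) <= r) -> udist cod_le cod_act g h <= r.
Proof.
  intros Hr H; apply Rmax_lub; apply rho_le; auto; intros u v Huv y;
    specialize (H y); apply Rabs_le_between in H;
    apply (U_le_of_shift u v r); auto; lra.
Qed.

Section Isometry.
Variables (Psi : PClass) (A : UInfLat Psi).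

Lemma udist_le_of_iota (a b : A) r : archimedean A -> unstackable A -> 0 <= r ->
  (forall f : UInfPoset A, Rabs (proj1_sig f a - proj1_sig f b) <= r) ->
  udist (@le A) (act A) a b <= r.
Proof.
  intros HA HU Hr H; apply Rmax_lub; apply rho_le; auto; intros u v Huv;
    apply iota_reflects_le; auto; intros f; rewrite !UInf_act;
    specialize (H f); apply Rabs_le_between in H;
    apply (U_le_of_shift u v r); auto; lra.
Qed.

(** Strict bounds are used because a distance below [e] directly supplies a shift [r < e];
    evaluating it under [f] gives the estimate. *)
Lemma iota_of_udist_lt (a b : A) e (f : UInfPoset A) :
  udist (@le A) (act A) a b < e -> Rabs (proj1_sig f a - proj1_sig f b) < e.
Proof.
  assert (K : forall a b : A, rho (@le A) (act A) a b < e ->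
    proj1_sig f a < proj1_sig f b + e).
  { intros c d H; apply rho_lt in H; destruct H as [r [Hr H]].
    enough (proj1_sig f c <= proj1_sig f d + r) by lra.
    apply shift_of_U_le; [lra|apply UInf_range|apply UInf_range|].
    intros u v Huv; rewrite <- !UInf_act; apply UInf_mono, H, Huv. }
  unfold udist; intros H.
  pose proof (K a b ltac:(eapply Rle_lt_trans; [apply Rmax_l|apply H])).
  pose proof (K b a ltac:(eapply Rle_lt_trans; [apply Rmax_r|apply H])).
  apply Rabs_lt_between; lra.
Qed.

End Isometry.

(** * Embedding, density and surjectivity of evaluation *)

Theorem theorem5p2 (Phi Psi : PClass)
  (HPhi : is_join_doctrine Phi) (HPsi : is_join_doctrine Psi)
  (Homega : Phi omega) (Hsound : sound_dual Phi Psi)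
  (A : UInfLat Psi) (HArch : archimedean A) (HUnst : unstackable A) :
  (* iota is a well-defined embedding of U-Psi^op-inflattices *)
  ((forall a : A, is_PhiCtsHom Phi (UInfPoset A) (iota A a)) /\
   (forall (u : U) (a : A) f, iota A (act A u a) f = cod_act u (iota A a) f) /\
   (forall (S : A -> Prop) (m : A), Psi (opp (sub A S)) -> is_glb A S m ->
      forall f, glbI (fun t => exists s, S s /\ t = iota A s f) (iota A m f)) /\
   (forall a b : A, le a b <-> cod_le (iota A a) (iota A b))) /\
  (* if A is stackable, the image of iota is dense *)
  (stackable A ->
   forall g : UInfPoset A -> R, is_PhiCtsHom Phi (UInfPoset A) g ->
   forall eps, 0 < eps -> exists a : A, udist cod_le cod_act (iota A a) g < eps) /\
  (* if A is stackable and complete, iota is onto (hence an isomorphism) *)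
  (stackable A -> complete A ->
   forall g : UInfPoset A -> R, is_PhiCtsHom Phi (UInfPoset A) g ->
   exists a : A, forall f, iota A a f = g f).
Proof.
  split; [split; [|split; [|split]]|split].
  - intros a; apply iota_PhiCtsHom; auto.
  - intros u a f; apply UInf_act.
  - intros S m HS Hm f; apply (UInf_meets Psi A f S m HS Hm).
  - intros a b; split.
    + intros Hab f; apply UInf_mono, Hab.
    + intros H; apply iota_reflects_le; auto.
  - intros HS g Hg eps Heps.
    destruct (iota_dense_uniform Phi Psi A g HPhi HPsi Hsound Hg HArch HS (eps / 2))
      as [a Ha]; [lra|].
    exists a; apply Rle_lt_trans with (eps / 2); [apply cod_udist_le; [lra|exact Ha]|lra].
  - intros HS [_ HC] g Hg.
    assert (Hs : forall n : nat, {a : A | forall f : UInfPoset A,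
      Rabs (proj1_sig f a - g f) <= / (INR n + 1)}).
    { intros n; apply constructive_indefinite_description.
      apply (iota_dense_uniform Phi Psi A g); auto.
      apply Rinv_0_lt_compat; pose proof (pos_INR n); lra. }
    set (s := fun n => proj1_sig (Hs n)).
    assert (Hsg : forall e, 0 < e -> exists N, forall n, (N <= n)%nat ->
      forall f : UInfPoset A, Rabs (proj1_sig f (s n) - g f) <= e).
    { intros e He; destruct (INR_archimed e 1 He) as [N HN]; exists N; intros n Hn f.
      eapply Rle_trans; [apply (proj2_sig (Hs n))|].
      pose proof (le_INR _ _ Hn); pose proof (pos_INR N).
      rewrite <- (Rinv_inv e); apply Rinv_le_contravar; [apply Rinv_0_lt_compat; lra|].
      apply Rmult_le_reg_r with e; auto; rewrite Rinv_l by lra; nra. }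
    destruct (HC s) as [a Ha].
    (* Uniform closeness to [g] makes the approximants Cauchy in [A], because uniform bounds on
       evaluations bound [udist]. *)
    + intros eps Heps; destruct (Hsg (eps / 4)) as [N HN]; [lra|].
      exists N; intros m n Hm Hn; apply Rle_lt_trans with (eps / 2); [|lra].
      apply udist_le_of_iota; auto; [lra|]; intros f.
      pose proof (HN m Hm f) as H1; pose proof (HN n Hn f) as H2.
      apply Rabs_le_between in H1, H2; apply Rabs_le; lra.
    + exists a; intros f; unfold iota; apply cond_eq; intros eps Heps.
      destruct (Hsg (eps / 2)) as [N HN]; [lra|].
      destruct (Ha (eps / 2)) as [N' HN']; [lra|].
      pose proof (HN (N + N')%nat ltac:(lia) f) as H1.
      pose proof (iota_of_udist_lt Psi A _ _ _ f (HN' (N + N')%nat ltac:(lia))) as H2.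
      apply Rabs_le_between in H1; apply Rabs_lt_between in H2; apply Rabs_lt_between; lra.
Qed.
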